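(* Let $w\in\{\mathtt0,\mathtt1\}^*$. The map $\Phi:M(w)\to J(F(\theta(w)))$ defined by \[ \Phi(m)=\{|p| : w=ps,\ \mathrm{region}(S_{\vec p})\subseteq\mathrm{region}(m\Delta\mathfrak{b}_w)\} \] is an order-preserving bijection from $(M(w),\prec)$ to $(J(F(\theta(w))),\subseteq)$ such that: (1) $m\in M^\perp(w)$ if and only if $\Phi(m)\in J^\bullet(F(\theta(w)))$; (2) $m\in M^\parallel(w)$ if and only if $\Phi(m)\in J^\circ(F(\theta(w)))$; (3) for every $m\in M(w)$, $\mathrm{area}(m\Delta\mathfrak{b}_w)=|\Phi(m)|$.
   Context: For words over $\{\mathtt0,\mathtt1\}$: $\overline{\mathtt0}=\mathtt1,\overline{\mathtt1}=\mathtt0$; $\theta(\varepsilon)=\varepsilon$, $\theta(\alpha w)=\overline{\alpha}\theta(w)$ if $|w|$ even, $\alpha\theta(w)$ if $|w|$ odd. For $u=u_1\cdots u_n$, the fence poset $F(u)$ has elements $y_0,\dots,y_n$ (identified with indices $0,\dots,n$) with covering relations $y_{i-1}\lhd y_i$ if $u_i=\mathtt0$ and $y_{i-1}\rhd y_i$ if $u_i=\mathtt1$; $J(F(u))$ is its set of lower order ideals, $J^\bullet$ those containing $0$, $J^\circ$ those not containing $0$. For a word $p$, $\vec p=(|p|_\mathtt0,|p|_\mathtt1)$; $S_g$ is the set of four edges of the unit square with lower-left corner $g\in\mathbb{Z}^2$, and $\mathrm{region}(S_g)$ is that closed unit square. The snake graph $G(w)$ has vertex set $\{\vec p:p\text{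 prefix of }w\}+\{(0,0),(1,0),(0,1),(1,1)\}$ and edge set $\bigcup_{p\text{ prefix of }w}S_{\vec p}$, embedded in $\mathbb{R}^2$. $M(w)$ is its set of perfect matchings. The first edge of a perfect matching is the one containing $(0,0)$, the last edge the one containing $\vec w+(1,1)$. $M^\perp(w)$: perfect matchings with ($|w|$ even and first edge horizontal) or ($|w|$ odd and first edge vertical); $M^\parallel(w)$: the others. An edge $(u,v)$ is interior if the subgraph induced on the vertices other than $u,v$ is disconnected, otherwise boundary; of the two perfect matchings using only boundary edges, the basic matching $\mathfrak{b}_w$ is the one whose last edge is vertical. For $m\in M(w)$, $m\Delta\mathfrak b_w$ is a disjoint union of cycles; $\mathrm{region}(m\Delta\mathfrak b_w)\subset\mathbb{R}^2$ is the bounded region they enclose and $\mathrm{area}$ its area. The order on $M(w)$: $m\prec m'$ iff $\mathrm{region}(m\Delta\mathfrak b_w)\subseteq\mathrm{region}(m'\Delta\mathfrak b_w)$.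
   Formalization: The relation x ◁ y in the fence poset is read as ''x covers y'' (x above y), since with the usual reading ''y covers x'' the claim fails for every nonempty w: for w = 0 the set {0} is a value of Φ, but θ(w) = 1 would put y_1 below y_0. *)

(* Defs.v *)
From HB Require Import structures.
From Stdlib Require Import Relation_Operators.
From mathcomp Require Import all_boot all_order all_algebra.
From mathcomp Require Import all_classical all_reals all_analysis.
Import Order.TTheory GRing.Theory Num.Theory.
Import numFieldNormedType.Exports.

Set Implicit Arguments.
Unset Strict Implicit.
Unset Printing Implicit Defensive.

Local Open Scope classical_set_scope.
Local Open Scope ring_scope.

(* The letter 0 is [false] and the letter 1 is [true]. *)
Definition word := seq bool.

Fixpoint theta (u : word) : word :=
  if u is a :: w then (if odd (size w) then a else ~~ a) :: theta w
  else [::].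

Section FencePoset.
Variable u : word.

(* [fence_cover x y] is the relation x <| y, for y_x and y_y in F(u); the
   letter u_i is [nth false u i.-1]. *)
Definition fence_cover : rel 'I_(size u).+1 := fun x y =>
  ((val y == x.+1) && ~~ nth false u x) || ((val x == y.+1) && nth false u y).

(* Orientation: x <| y is read "x covers y", so that y lies below x. With the
   opposite orientation [Phi] below does not take its values in the lower
   ideals: for w = 0, the basic matching together with the matching made of the
   three vertical edges enclose the first square only, so {0} is a value of
   [Phi], whereas theta(w) = 1 would put y_1 below y_0. *)
Definition fence_le : rel 'I_(size u).+1 :=
  connect (fun x y => fence_cover y x).

Definition lower_ideals : set {set 'I_(size u).+1} :=
  [set I | forall x y, fence_le x y -> y \in I -> x \in I].

Definition lower_ideals_with0 : set {set 'I_(size u).+1} :=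
  [set I | lower_ideals I /\ ord0 \in I].

Definition lower_ideals_without0 : set {set 'I_(size u).+1} :=
  [set I | lower_ideals I /\ ord0 \notin I].

End FencePoset.

Arguments fence_cover u : clear implicits.
Arguments fence_le u : clear implicits.
Arguments lower_ideals u : clear implicits.
Arguments lower_ideals_with0 u : clear implicits.
Arguments lower_ideals_without0 u : clear implicits.

Definition vertex : Type := (int * int)%type.

(* Unit edges of the square grid, each named by its left, resp. lower, end. *)
Inductive edge := Horizontal of vertex | Vertical of vertex.

Definition ends (e : edge) : set vertex :=
  match e with
  | Horizontal g => [set g; g + (1, 0)]
  | Vertical g => [set g; g + (0, 1)]
  end.

Definition horizontal (e : edge) := if e is Horizontal _ then true else false.
Definition vertical (e : edge) := ~~ horizontal e.

Definition square_edges (g : vertex) : set edge :=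
  [set Horizontal g; Horizontal (g + (0, 1)); Vertical g; Vertical (g + (1, 0))].

Definition abel (p : word) : vertex :=
  ((count_mem false p)%:Z, (count_mem true p)%:Z).

Section SnakeGraph.
Variable w : word.

Definition snake_vertices : set vertex :=
  [set abel p + d | p in [set p : word | prefix p w]
                  & d in [set (0, 0); (1, 0); (0, 1); (1, 1)]].

Definition snake_edges : set edge :=
  \bigcup_(p in [set p : word | prefix p w]) square_edges (abel p).

Definition perfect_matchings : set (set edge) :=
  [set m | m `<=` snake_edges /\
           forall v, snake_vertices v -> exists! e, m e /\ ends e v].

Definition first_edge (m : set edge) (e : edge) := m e /\ ends e (0, 0).

Definition last_edge (m : set edge) (e : edge) :=
  m e /\ ends e (abel w + (1, 1)).

Definition perp_matchings : set (set edge) :=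
  [set m | perfect_matchings m /\
     ((~~ odd (size w) /\ exists2 e, first_edge m e & horizontal e) \/
      (odd (size w) /\ exists2 e, first_edge m e & vertical e))].

Definition parallel_matchings : set (set edge) :=
  perfect_matchings `\` perp_matchings.

Definition induced_adj (U : set vertex) (x y : vertex) : Prop :=
  [/\ U x, U y & exists2 e, snake_edges e & ends e = [set x; y]].

Definition induced_disconnected (U : set vertex) : Prop :=
  exists x y, [/\ U x, U y & ~ clos_refl_trans vertex (induced_adj U) x y].

Definition interior_edge (e : edge) : Prop :=
  snake_edges e /\ induced_disconnected (snake_vertices `\` ends e).

Definition boundary_edge (e : edge) : Prop :=
  snake_edges e /\ ~ interior_edge e.

Definition is_basic_matching (b : set edge) : Prop :=
  [/\ perfect_matchings b, b `<=` boundary_edge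
    & exists2 e, last_edge b e & vertical e].

Definition basic_matching : set edge :=
  xget set0 [set b | is_basic_matching b].

End SnakeGraph.

Section Geometry.
Variable R : realType.

Definition segment (e : edge) : set (R * R) :=
  match e with
  | Horizontal g => `[g.1%:~R, g.1%:~R + 1] `*` [set g.2%:~R]
  | Vertical g => [set g.1%:~R] `*` `[g.2%:~R, g.2%:~R + 1]
  end.

Definition drawing (E : set edge) : set (R * R) := \bigcup_(e in E) segment e.

(* The curve together with the bounded components of its complement. *)
Definition region (E : set edge) : set (R * R) :=
  drawing E `|`
  [set z | (~` drawing E) z /\
           bounded_set (connected_component (~` drawing E) z)].

Definition unit_square (g : vertex) : set (R * R) :=
  `[g.1%:~R, g.1%:~R + 1] `*` `[g.2%:~R, g.2%:~R + 1].

Definition area (A : set (R * R)) : \bar R :=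
  (lebesgue_measure \x lebesgue_measure)%E A.

Variable w : word.

Definition matching_region (m : set edge) : set (R * R) :=
  region (m `+` basic_matching w).

Definition matching_le (m m' : set edge) : Prop :=
  matching_region m `<=` matching_region m'.

Definition Phi (m : set edge) : {set 'I_(size (theta w)).+1} :=
  [set k : 'I_(size (theta w)).+1 |
     `[< exists p s : word,
           [/\ w = p ++ s, size p = k
             & unit_square (abel p) `<=` matching_region m] >] ]%SET.

End Geometry.

Arguments segment R e : clear implicits.
Arguments drawing R E : clear implicits.
Arguments region R E : clear implicits.
Arguments unit_square R g : clear implicits.
Arguments matching_region R w m : clear implicits.
Arguments matching_le R w m m' : clear implicits.
Arguments Phi R w m : clear implicits.

(* Main.v *)
(* Cut the snake graph by the levels [x + y = k]. Between levels [k] and [k + 1]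
   it has exactly three edges: the rung shared by the squares [k - 1] and [k],
   and one boundary edge ("rail") of each of these two squares. Put the letters 0
   and 1 at the two ends of [theta w], and let [u_k] be the letter of index [k].
   A perfect matching is then the same thing as an indicator function [i] of
   squares for which the rail of square [k - 1], the rung and the rail of square
   [k] have the respective bits [u_k + i (k-1)], [i (k-1) + i k] and
   [1 + u_k + i k] modulo 2; solving level by level, the vertices impose exactly
   the order relation of the fence between [k - 1] and [k]. In other words the
   matching is the basic matching plus the boundary modulo 2 of a set of squares
   forming a lower ideal. The region enclosed by that boundary is the union of
   the squares: from a point outside the union, after a small translation, one of
   the two antidiagonal rays avoids the squares and escapes to infinity. *)
Require Import Defs.
From Stdlib Require Import Relation_Operators.
From mathcomp Require Import all_boot all_order all_algebra.
From mathcomp Require Import all_classical all_reals all_analysis.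
From mathcomp Require Import zify lra.
Import Order.TTheory GRing.Theory Num.Theory.
Import numFieldNormedType.Exports.

Set Implicit Arguments.
Unset Strict Implicit.
Unset Printing Implicit Defensive.

Local Open Scope classical_set_scope.
Local Open Scope ring_scope.

(** * Levels of the snake graph *)

Definition level (v : vertex) : int := v.1 + v.2.

Definition base (e : edge) : vertex :=
  match e with Horizontal g => g | Vertical g => g end.

Lemma vertex_eq (u v : vertex) : u.1 = v.1 -> u.2 = v.2 -> u = v.
Proof. by case: u v => [a b] [c d] /= -> ->. Qed.

Definition edge_bit (m : set edge) (e : edge) : bool := `[< m e >].

Lemma edge_bitP m e : reflect (m e) (edge_bit m e).
Proof. exact: asboolP. Qed.

Section Ladder.
Variable w : word.
Local Notation n := (size w).

(* The path of lower-left corners of the squares, prolonged beyond [n] by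
   letters 1 so that the top of the last square behaves like a further rung. *)
Definition corner (k : nat) : vertex := abel (mkseq (nth true w) k).

(* The value at 0 is the one for which [fence_letter 0] below is 0. *)
Definition letter (k : nat) : bool :=
  if k is j.+1 then nth true w j else ~~ odd n.

Definition rung (k : nat) : edge :=
  if letter k then Horizontal (corner k) else Vertical (corner k).

Definition new_rail (k : nat) : edge :=
  if letter k then Vertical (corner k) else Horizontal (corner k).

Definition opposite_corner (k : nat) : vertex :=
  corner k + (if letter k then (1, -1) else (-1, 1)).

Definition old_rail (k : nat) : edge :=
  if letter k then Vertical (opposite_corner k) else Horizontal (opposite_corner k).

Definition rung_end (k : nat) : vertex :=
  corner k + (if letter k then (1, 0) else (0, 1)).

Definition rail_end (k : nat) : vertex :=
  corner k + (if letter k then (0, 1) else (1, 0)).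

Lemma cornerS k :
  corner k.+1 = corner k + (if letter k.+1 then (0, 1) else (1, 0)).
Proof.
rewrite /corner /abel mkseqS -cats1 !count_cat /=.
by case: (nth true w k); congr (_, _) => /=; rewrite ?addn0 ?addn1 ?addr0; lia.
Qed.

Lemma level_corner k : level (corner k) = k.
Proof.
by elim: k => // k; rewrite cornerS /level /=; case: (nth _ _ _) => /=; lia.
Qed.

Lemma corner_prefix p : prefix p w -> abel p = corner (size p).
Proof.
case/prefixP=> s ws; congr abel; apply: (@eq_from_nth _ true).
  by rewrite size_mkseq.
by move=> i ip; rewrite nth_mkseq // ws nth_cat ip.
Qed.

Lemma corner_take k : (k <= n)%N -> abel (take k w) = corner k.
Proof.
by move=> kn; rewrite corner_prefix ?prefix_take ?size_takel.
Qed.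

Lemma snake_edgeP e : snake_edges w e <->
  exists2 k, (k <= n)%N & square_edges (corner k) e.
Proof.
split=> [[p /= pw]|[k kn]].
  rewrite (corner_prefix pw) => pe; exists (size p) => //.
  by case/prefixP: pw => s ->; rewrite size_cat leq_addr.
by rewrite -corner_take // => ke; exists (take k w) => //=; exact: prefix_take.
Qed.


Ltac edge_eq :=
  solve [congr Horizontal; apply: vertex_eq; rewrite /=; lia
        |congr Vertical; apply: vertex_eq; rewrite /=; lia].

Ltac edge_cases :=
  rewrite /rung /new_rail /old_rail /opposite_corner /rung_end /rail_end;
  rewrite ?cornerS /=.

Lemma square_edges_corner k e : square_edges (corner k) e <->
  [\/ e = rung k, e = new_rail k, e = rung k.+1 | e = old_rail k.+1].
Proof.
edge_cases.
case: (letter k); case: (nth true w k); split => /=.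
all: try by case=> [[[]|]|] ->;
  first [apply: Or41; edge_eq|apply: Or42; edge_eq
        |apply: Or43; edge_eq|apply: Or44; edge_eq].
all: by case=> ->;
  first [do 3 left; edge_eq|do 2 left; right; edge_eq
        |left; right; edge_eq|right; edge_eq].
Qed.

Lemma snake_edgeE e : snake_edges w e <->
  exists2 k, (k <= n.+1)%N &
    [\/ e = rung k, (k <= n)%N /\ e = new_rail k | (0 < k)%N /\ e = old_rail k].
Proof.
rewrite snake_edgeP; split=> [[k kn /square_edges_corner[]]|[k kn]] ek.
- by exists k; [exact: leqW|exact: Or31].
- by exists k; [exact: leqW|exact: Or32].
- by exists k.+1; [|exact: Or31].
- by exists k.+1; [|exact: Or33].
case: ek kn => [e_k|[kn e_k] _|[]].
- rewrite leq_eqVlt ltnS => /orP[/eqP kn|kn].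
    by exists n => //; apply/square_edges_corner; rewrite -kn; exact: Or43.
  by exists k => //; apply/square_edges_corner; exact: Or41.
- by exists k => //; apply/square_edges_corner; exact: Or42.
- case: k => // k _ e_k kn; exists k => //.
  by apply/square_edges_corner; exact: Or44.
Qed.

Lemma level_rung k : level (base (rung k)) = k.
Proof. by rewrite -[RHS]level_corner /rung; case: letter. Qed.

Lemma level_new_rail k : level (base (new_rail k)) = k.
Proof. by rewrite -[RHS]level_corner /new_rail; case: letter. Qed.

Lemma level_old_rail k : level (base (old_rail k)) = k.
Proof.
rewrite -[RHS]level_corner /old_rail /opposite_corner /level.
by case: letter => /=; lia.
Qed.

Lemma snake_edge_level k e : level (base e) = k%:Z -> snake_edges w e ->
  (k <= n.+1)%N /\
  [\/ e = rung k, (k <= n)%N /\ e = new_rail k | (0 < k)%N /\ e = old_rail k].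
Proof.
move=> ek /snake_edgeE[j jn je]; suff <- : j = k by [].
move: ek; case: je => [->|[_ ->]|[_ ->]].
- by rewrite level_rung => -[].
- by rewrite level_new_rail => -[].
- by rewrite level_old_rail => -[].
Qed.

Lemma snake_edge_level_ge0 e : snake_edges w e -> 0 <= level (base e).
Proof.
by case/snake_edgeE=> j jn [->|[_ ->]|[_ ->]];
  rewrite ?level_rung ?level_new_rail ?level_old_rail.
Qed.

Lemma snake_vertexE v : snake_vertices w v <->
  [\/ v = corner 0,
      exists2 k, (k <= n)%N & v = corner k + (1, 0) \/ v = corner k + (0, 1)
    | v = corner n + (1, 1)].
Proof.
have sq d k : (k <= n)%N -> [set (0, 0); (1, 0); (0, 1); (1, 1)] d ->
    snake_vertices w (corner k + d).
  move=> kn dP; exists (take k w); first exact: prefix_take.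
  by exists d => //; rewrite corner_take.
split=> [[p pw [d dP <-]]|[->|[k kn []] ->|->]].
- rewrite corner_prefix //.
  have : (size p <= n)%N.
    by case/prefixP: pw => s ->; rewrite size_cat leq_addr.
  move: (size p) => k kn; case: dP => [[[]|]|] -> /=.
  + case: k kn => [|k] kn; first by apply: Or31; exact: vertex_eq.
    apply: Or32; exists k; first exact: ltnW.
    by rewrite cornerS; case: letter; [right|left]; apply: vertex_eq => /=; lia.
  + by apply: Or32; exists k => //; left.
  + by apply: Or32; exists k => //; right.
  + case: (ltngtP k n) kn => // [kn _|-> _]; last exact: Or33.
    apply: Or32; exists k.+1; first by [].
    by rewrite cornerS; case: letter; [left|right]; apply: vertex_eq => /=; lia.
- by rewrite -[X in snake_vertices _ X]addr0; apply: sq => //; do 3 left.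
- by apply: sq => //; do 2 left; right.
- by apply: sq => //; left; right.
- by apply: sq => //; right.
Qed.

End Ladder.

Definition one_of (s : seq bool) := count id s == 1%N.

Lemma ends_edgeE e v : ends e v <->
  [\/ e = Horizontal v, e = Vertical v, e = Horizontal (v - (1, 0)) |
      e = Vertical (v - (0, 1))].
Proof.
split.
  case: e => g /= [] ->.
  - exact: Or41.
  - by apply: Or43; rewrite addrK.
  - exact: Or42.
  - by apply: Or44; rewrite addrK.
case=> -> /=; [left|left|right|right] => //=; by rewrite subrK.
Qed.

Lemma matched_onceE (m : set edge) v : (exists! e, m e /\ ends e v) <->
  one_of [:: edge_bit m (Horizontal v); edge_bit m (Vertical v);
             edge_bit m (Horizontal (v - (1, 0)));
             edge_bit m (Vertical (v - (0, 1)))].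
Proof.
have d1 : v <> v - (1, 0) by move/(congr1 fst) => /=; lia.
have d2 : v <> v - (0, 1) by move/(congr1 snd) => /=; lia.
set e1 := Horizontal v; set e2 := Vertical v.
set e3 := Horizontal (v - (1, 0)); set e4 := Vertical (v - (0, 1)).
have [e1v e2v e3v e4v] : [/\ ends e1 v, ends e2 v, ends e3 v & ends e4 v].
  by split; apply/ends_edgeE; [apply: Or41|apply: Or42|apply: Or43|apply: Or44].
split.
- case=> e [[me /ends_edgeE ev] uniq_e].
  have bitE f : ends f v -> e <> f -> edge_bit m f = false.
    by move=> fv ef; apply/edge_bitP => mf; apply: ef; exact: uniq_e.
  have bitT : edge_bit m e by apply/edge_bitP.
  rewrite /one_of; case: ev => eE; subst e; rewrite /= bitT !bitE //;
    by move=> [] // /esym.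
- have bitF f : edge_bit m f = false -> ~ m f by move/edge_bitP.
  rewrite /one_of /=.
  case h1 : (edge_bit m e1); case h2 : (edge_bit m e2);
  case h3 : (edge_bit m e3); case h4 : (edge_bit m e4) => //= _;
  [exists e1|exists e2|exists e3|exists e4].
  all: split; first by split=> //; exact/edge_bitP.
  all: move=> f [mf /ends_edgeE[] fE] //; rewrite fE in mf.
  all: by case: (bitF _ _ mf).
Qed.

(** * Perfect matchings as bit sequences *)

Section VertexConditions.
Variable w : word.
Local Notation n := (size w).

Lemma off_snake k g : level g = k%:Z -> g <> corner w k ->
  ~ snake_edges w (if letter w k then Horizontal g else Vertical g).
Proof.
move=> gk gP s.
have bk : level (base (if letter w k then Horizontal g else Vertical g)) = k.
  by case: letter.
case: (snake_edge_level bk s) => _.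
rewrite /rung /new_rail /old_rail.
by case: (letter w k) => -[[]|[_]|[_]].
Qed.

Section Bits.
Variable m : set edge.
Hypothesis m_snake : m `<=` snake_edges w.
Let A k := edge_bit m (old_rail w k).
Let B k := edge_bit m (rung w k).
Let C k := edge_bit m (new_rail w k).

Lemma edge_bit_off e : ~ snake_edges w e -> edge_bit m e = false.
Proof. by move=> es; apply/edge_bitP => /m_snake. Qed.

Lemma edge_bit_old_rail0 : edge_bit m (old_rail w 0) = false.
Proof.
apply: edge_bit_off => /(snake_edge_level (level_old_rail w 0))[_].
rewrite /rung /new_rail /old_rail /opposite_corner; case: (letter w 0).
all: by case=> [[]|[_ []]|[]].
Qed.

Lemma edge_bit_new_rail_last : edge_bit m (new_rail w n.+1) = false.
Proof.
apply: edge_bit_off => /(snake_edge_level (level_new_rail w _))[_].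
rewrite /rung /new_rail /old_rail /opposite_corner /= nth_default //=.
case=> [//|[]|[_ /(congr1 (fun e => (base e).1))]]; first by rewrite ltnn.
by move=> /=; lia.
Qed.

Lemma edge_bit_below e : level (base e) = -1 -> edge_bit m e = false.
Proof.
by move=> e1; apply: edge_bit_off => /snake_edge_level_ge0; rewrite e1.
Qed.

Lemma edge_bit_above e : level (base e) = n.+2 -> edge_bit m e = false.
Proof.
by move=> e1; apply: edge_bit_off => /(snake_edge_level e1)[]; rewrite ltnn.
Qed.

Lemma off_ladder k d : d = (1, -1) \/ d = (-1, 1) ->
  let g := corner w k + d in
  edge_bit m (if letter w k then Horizontal g else Vertical g) = false.
Proof.
move=> d11.
have dk : level (corner w k + d) = k.
  by rewrite -[RHS](level_corner w k) /level; case: d11 => -> /=; lia.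
have dP : corner w k + d <> corner w k.
  by move/(congr1 fst); case: d11 => -> /=; lia.
exact: edge_bit_off (off_snake dk dP).
Qed.

Definition level_ok k :=
  if letter w k == letter w k.+1 then
    one_of [:: C k; B k.+1; C k.+1] && one_of [:: A k; B k; A k.+1]
  else one_of [:: A k; B k; B k.+1; C k.+1] && one_of [:: C k; A k.+1].

Lemma matched_levelE k :
  (exists! e, m e /\ ends e (corner w k + (1, 0))) /\
  (exists! e, m e /\ ends e (corner w k + (0, 1))) <-> level_ok k.
Proof.
rewrite !matched_onceE (rwP andP).
have R1 := off_ladder k (or_introl erefl).
have L1 := off_ladder k (or_intror erefl).
have R2 := off_ladder k.+1 (or_introl erefl).
have L2 := off_ladder k.+1 (or_intror erefl).
move: R1 L1 R2 L2.
rewrite /level_ok /A /B /C /rung /new_rail /old_rail /opposite_corner cornerS.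
set P := corner w k.
rewrite addrK addrK.
have -> : P + (1, 0) - (0, 1) = P + (1, -1) by apply: vertex_eq => /=; lia.
have -> : P + (0, 1) - (1, 0) = P + (-1, 1) by apply: vertex_eq => /=; lia.
have LR : P + (0, 1) + (1, -1) = P + (1, 0) by apply: vertex_eq => /=; lia.
have RL : P + (1, 0) + (-1, 1) = P + (0, 1) by apply: vertex_eq => /=; lia.
case: (letter w k); case: (letter w k.+1); rewrite ?LR ?RL /=.
all: move=> R1 L1 R2 L2; rewrite /one_of /= ?R1 ?L1 ?R2 ?L2 /=.
all: repeat match goal with |- context [edge_bit m ?e] =>
  case: (edge_bit m e) end => /=.
all: by split.
Qed.

Lemma matched_firstE : (exists! e, m e /\ ends e (corner w 0)) <->
  one_of [:: B 0; C 0].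
Proof.
rewrite matched_onceE (@edge_bit_below (Horizontal (corner w 0 - (1, 0)))) //.
rewrite (@edge_bit_below (Vertical (corner w 0 - (0, 1)))) // /B /C /rung /new_rail.
by case: (letter w 0); case: (edge_bit _ _); case: (edge_bit _ _).
Qed.

Lemma matched_lastE : (exists! e, m e /\ ends e (corner w n + (1, 1))) <->
  one_of [:: A n.+1; B n.+1].
Proof.
have top e : base e = corner w n + (1, 1) -> edge_bit m e = false.
  move=> eb; apply: edge_bit_above; rewrite eb.
  by have := level_corner w n; rewrite /level /=; lia.
rewrite matched_onceE (top (Horizontal _)) // (top (Vertical (_ + _))) //.
rewrite /A /B /old_rail /rung.
rewrite /opposite_corner cornerS /= nth_default //=.
have -> : corner w n + (1, 1) - (1, 0) = corner w n + (0, 1).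
  by apply: vertex_eq => /=; lia.
have -> : corner w n + (1, 1) - (0, 1) = corner w n + (0, 1) + (1, -1).
  by apply: vertex_eq => /=; lia.
by case: (edge_bit _ _); case: (edge_bit _ _).
Qed.

End Bits.

Lemma perfect_matchingsE m : perfect_matchings w m <->
  m `<=` snake_edges w /\
  [/\ one_of [:: edge_bit m (rung w 0); edge_bit m (new_rail w 0)],
      forall k, (k <= n)%N -> level_ok m k
    & one_of [:: edge_bit m (old_rail w n.+1); edge_bit m (rung w n.+1)]].
Proof.
split=> -[ms mP]; split=> //.
  split.
  - by rewrite -matched_firstE //; apply/mP/snake_vertexE; apply: Or31.
  - move=> k kn; apply/matched_levelE => //.
    by split; apply: mP; apply/snake_vertexE; apply: Or32; exists k; auto.
  - by rewrite -matched_lastE //; apply/mP/snake_vertexE; apply: Or33.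
case: mP => first_ok levels_ok last_ok v /snake_vertexE[->|[k kn vk]|->].
- exact/matched_firstE.
- by case/matched_levelE: (levels_ok k kn) vk => // R L [] ->.
- exact/matched_lastE.
Qed.

Lemma snake_edges_eq m m' : m `<=` snake_edges w -> m' `<=` snake_edges w ->
  (forall k, (k <= n.+1)%N ->
    [/\ edge_bit m (old_rail w k) = edge_bit m' (old_rail w k),
        edge_bit m (rung w k) = edge_bit m' (rung w k)
      & edge_bit m (new_rail w k) = edge_bit m' (new_rail w k)]) -> m = m'.
Proof.
move=> ms m's bits; apply/seteqP; split=> e em.
  have [k /bits[bA bB bC] ek] := iffLR (snake_edgeE w e) (ms e em).
  by case: ek em => [->|[_ ->]|[_ ->]] /edge_bitP; rewrite ?bA ?bB ?bC => /edge_bitP.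
have [k /bits[bA bB bC] ek] := iffLR (snake_edgeE w e) (m's e em).
by case: ek em => [->|[_ ->]|[_ ->]] /edge_bitP;
  rewrite -?bA -?bB -?bC => /edge_bitP.
Qed.

End VertexConditions.

(** * Matchings and ideals of the fence *)

Definition boundary (S : set vertex) : set edge :=
  [set e | match e with
           | Horizontal g => (`[< S g >] (+) `[< S (g - (0, 1)) >] : Prop)
           | Vertical g => `[< S g >] (+) `[< S (g - (1, 0)) >]
           end].

Lemma edge_bit_setY A B e :
  edge_bit (A `+` B) e = edge_bit A e (+) edge_bit B e.
Proof.
rewrite /edge_bit /setY; apply/asboolP/idP.
  by case=> -[] => [/asboolT -> /asboolF ->|/asboolT -> /asboolF ->].
by case: asboolP; case: asboolP => // Be Ae _; [left|right].
Qed.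

Section Matchings.
Variable w : word.
Local Notation n := (size w).

(* The letter [u_k] of [theta w], extended by [u_0 = 0] and [u_{n+1} = 1]. *)
Definition fence_letter (k : nat) : bool := letter w k (+) ~~ odd (n + k).

Lemma fence_letter0 : fence_letter 0 = false.
Proof. by rewrite /fence_letter /= addn0 addbb. Qed.

Lemma fence_letter_last : fence_letter n.+1 = true.
Proof. by rewrite /fence_letter /= nth_default // addnS /= addnn odd_double. Qed.

Lemma fence_letter_turn k :
  (letter w k == letter w k.+1) = (fence_letter k != fence_letter k.+1).
Proof.
rewrite /fence_letter addnS /=.
by case: (letter w k); case: (nth true w k); case: (odd _).
Qed.

Lemma nth_theta k : (k < n)%N -> nth false (theta w) k = fence_letter k.+1.
Proof.
move=> kn; rewrite /fence_letter oddD -oddB //=.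
elim: w k kn => //= a v IH [|k] kn; first by rewrite subn1 /=; case: odd; case: a.
by rewrite [LHS]IH.
Qed.

Definition base_matching : set edge :=
  [set e | exists2 k, (k <= n.+1)%N &
    e = if fence_letter k then old_rail w k else new_rail w k].

Lemma rails_neq k : old_rail w k <> new_rail w k.
Proof.
rewrite /old_rail /new_rail /opposite_corner.
by case: (letter w k) => /(congr1 (fun e => (base e).1)) /=; lia.
Qed.

Lemma rung_neq_old_rail k : rung w k <> old_rail w k.
Proof. by rewrite /rung /old_rail; case: letter. Qed.

Lemma rung_neq_new_rail k : rung w k <> new_rail w k.
Proof. by rewrite /rung /new_rail; case: letter. Qed.

Lemma base_matching_level k e : level (base e) = k%:Z -> base_matching e ->
  (k <= n.+1)%N /\ e = if fence_letter k then old_rail w k else new_rail w k.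
Proof.
move=> ek [j jn ej]; suff <- : j = k by [].
move: ek; rewrite ej; case: fence_letter.
  by rewrite level_old_rail => -[].
by rewrite level_new_rail => -[].
Qed.

Lemma base_matching_old k : (k <= n.+1)%N ->
  edge_bit base_matching (old_rail w k) = fence_letter k.
Proof.
move=> kn; apply/edge_bitP/idP.
  case/(base_matching_level (level_old_rail w k)) => _.
  by case: fence_letter => // /rails_neq.
by exists k => //; rewrite H.
Qed.

Lemma base_matching_new k : (k <= n.+1)%N ->
  edge_bit base_matching (new_rail w k) = ~~ fence_letter k.
Proof.
move=> kn; apply/edge_bitP/idP.
  case/(base_matching_level (level_new_rail w k)) => _.
  by case: fence_letter => // /esym /rails_neq.
by exists k => //; rewrite (negbTE H).
Qed.

Lemma base_matching_rung k : edge_bit base_matching (rung w k) = false.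
Proof.
apply/edge_bitP => /(base_matching_level (level_rung w k))[_].
by case: ifP => _ => [/rung_neq_old_rail|/rung_neq_new_rail].
Qed.

Lemma base_matching_snake : base_matching `<=` snake_edges w.
Proof.
move=> e [k kn ->]; apply/snake_edgeE; exists k => //.
case: ifPn => kP; [apply: Or33|apply: Or32]; split=> //.
  by rewrite lt0n; apply: contraTneq kP => ->; rewrite fence_letter0.
rewrite -ltnS ltn_neqAle kn andbT; apply: contraNneq kP => ->.
by rewrite fence_letter_last.
Qed.

Section Squares.
Variable i : pred nat.

Definition squares : set vertex := [set corner w k | k in [set k | i k]].

Definition prev (k : nat) : bool := if k is j.+1 then i j else false.

Lemma squaresP k g : level g = k%:Z -> squares g <-> i k /\ corner w k = g.
Proof.
move=> gk; split=> [[j ij jg]|[ik kg]]; last by exists k.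
suff <- : j = k by [].
by move: gk; rewrite -jg level_corner => -[].
Qed.

Lemma squares_corner k : `[< squares (corner w k) >] = i k.
Proof.
apply/asboolP/idP => [/(squaresP (level_corner w k))[]//|ik].
by apply/(squaresP (level_corner w k)).
Qed.

Lemma squares_off k g : level g = k%:Z -> g <> corner w k ->
  `[< squares g >] = false.
Proof. by move=> gk gP; apply/asboolP => /(squaresP gk)[_ /esym]. Qed.

Lemma squares_prev k :
  `[< squares (corner w k - (if letter w k then (0, 1) else (1, 0))) >] = prev k.
Proof.
case: k => [|k]; last by rewrite cornerS addrK squares_corner.
apply/asboolP => -[j _ /(congr1 level)]; rewrite level_corner.
by case: (letter w 0).
Qed.

Lemma squares_prev_off k :
  `[< squares (corner w k - (if letter w k then (1, 0) else (0, 1))) >] = false.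
Proof.
case: k => [|k].
  apply/asboolP => -[j _ /(congr1 level)]; rewrite level_corner.
  by case: (letter w 0).
apply: (@squares_off k); rewrite cornerS.
  by rewrite -(level_corner w k) /level; case: (letter w k.+1) => /=; lia.
by case: (letter w k.+1) => /(congr1 fst) /=; lia.
Qed.

Lemma boundary_rung k : edge_bit (boundary squares) (rung w k) = prev k (+) i k.
Proof.
rewrite addbC -squares_corner -squares_prev /rung.
by rewrite /edge_bit /boundary /=; case: (letter w k); rewrite asboolb.
Qed.

Lemma boundary_new k : edge_bit (boundary squares) (new_rail w k) = i k.
Proof.
rewrite -[RHS]addbF -squares_corner -(squares_prev_off k) /new_rail.
by rewrite /edge_bit /boundary /=; case: (letter w k); rewrite asboolb.
Qed.

Lemma boundary_old k : edge_bit (boundary squares) (old_rail w k) = prev k.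
Proof.
have off : `[< squares (opposite_corner w k) >] = false.
  apply: (@squares_off k).
    by rewrite -[RHS](level_corner w k) /opposite_corner /level;
      case: (letter w k) => /=; lia.
  by rewrite /opposite_corner; case: (letter w k) => /(congr1 fst) /=; lia.
rewrite -squares_prev -[RHS]addFb -off /old_rail /opposite_corner.
rewrite /edge_bit /boundary /=; case: (letter w k); rewrite asboolb;
  congr (_ (+) `[< squares _ >]); apply: vertex_eq => /=; lia.
Qed.

Lemma boundary_snake : (forall k, i k -> (k <= n)%N) ->
  boundary squares `<=` snake_edges w.
Proof.
move=> i_n e be; apply/snake_edgeP.
have sq g f : squares g -> square_edges g f ->
    exists2 k, (k <= n)%N & square_edges (corner w k) f.
  by case=> k /= /i_n kn <-; exists k.
case: e be => g; rewrite /boundary /=.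
- case: asboolP => [/sq + _|_ /asboolP/sq]; apply.
    by do 3 left.
  by do 2 left; right; rewrite subrK.
- case: asboolP => [/sq + _|_ /asboolP/sq]; apply.
    by left; right.
  by right; rewrite subrK.
Qed.

Definition matching_of : set edge := base_matching `+` boundary squares.

Definition fence_ideal : Prop :=
  (forall k, i k -> (k <= n)%N) /\
  (forall k, (k < n)%N ->
     if fence_letter k.+1 then i k.+1 ==> i k else i k ==> i k.+1).

Lemma fence_ideal_step k : fence_ideal -> (k <= n.+1)%N ->
  if fence_letter k then i k ==> prev k else prev k ==> i k.
Proof.
case=> i_n i_le; case: k => [|k]; first by rewrite fence_letter0.
rewrite ltnS leq_eqVlt => /orP[/eqP ->|]; last exact: i_le.
by rewrite fence_letter_last; apply/implyP => /i_n; rewrite ltnn.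
Qed.

Lemma matching_of_bits k : (k <= n.+1)%N ->
  [/\ edge_bit matching_of (old_rail w k) = fence_letter k (+) prev k,
      edge_bit matching_of (rung w k) = prev k (+) i k
    & edge_bit matching_of (new_rail w k) = ~~ fence_letter k (+) i k].
Proof.
move=> kn; rewrite !edge_bit_setY boundary_old boundary_rung boundary_new.
by rewrite base_matching_rung base_matching_old ?base_matching_new.
Qed.

Lemma matching_of_snake : (forall k, i k -> (k <= n)%N) ->
  matching_of `<=` snake_edges w.
Proof.
by move=> i_n e [[/base_matching_snake]|[/boundary_snake-/(_ i_n)]].
Qed.

Lemma matching_of_perfect : fence_ideal -> perfect_matchings w matching_of.
Proof.
move=> iP; have [i_n _] := iP; apply/perfect_matchingsE.
split; first exact: matching_of_snake.
have [//|_ -> ->] := @matching_of_bits 0.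
have [//|-> -> _] := @matching_of_bits n.+1.
have step := fence_ideal_step iP.
rewrite fence_letter0 fence_letter_last; split; first by rewrite /=; case: (i 0).
  move=> k kn; have := step k (leqW kn); have := step k.+1 kn.
  rewrite /level_ok fence_letter_turn.
  have [|-> -> ->] := @matching_of_bits k; first exact: leqW.
  have [//|-> -> ->] := @matching_of_bits k.+1.
  rewrite [prev k.+1]/=.
  case: (fence_letter k); case: (fence_letter k.+1); case: (prev k);
    case: (i k); by case: (i k.+1).
have := step n.+1 (leqnn _); rewrite fence_letter_last /=.
have /negbTE -> : ~~ i n.+1 by apply/negP => /i_n; rewrite ltnn.
by case: (i n).
Qed.
End Squares.

Lemma perfect_matching_of m : perfect_matchings w m ->
  exists2 i, fence_ideal i & m = matching_of i.
Proof.
case/perfect_matchingsE => ms [first_ok levels_ok _].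
pose i k := (k <= n)%N && (edge_bit m (new_rail w k) (+) ~~ fence_letter k).
have i_n k : i k -> (k <= n)%N by case/andP.
have bitC k : (k <= n.+1)%N ->
    edge_bit m (new_rail w k) = ~~ fence_letter k (+) i k.
  rewrite leq_eqVlt /i => /orP[/eqP ->|]; last first.
    by rewrite ltnS => ->; case: edge_bit; case: fence_letter.
  by rewrite ltnn fence_letter_last; exact: edge_bit_new_rail_last.
have key k : (k <= n.+1)%N ->
  [/\ edge_bit m (old_rail w k) = fence_letter k (+) prev i k,
      edge_bit m (rung w k) = prev i k (+) i k
    & if fence_letter k then i k ==> prev i k else prev i k ==> i k].
  elim: k => [_|k IH kn].
    move: first_ok; rewrite (edge_bit_old_rail0 ms) bitC // fence_letter0.
    by rewrite /=; case: (i 0); case: edge_bit.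
  have [bA bB st] := IH (ltnW kn); have := levels_ok k kn.
  rewrite /level_ok fence_letter_turn bA bB !bitC //; last exact: ltnW.
  move: st; rewrite [prev i k.+1]/=.
  case: (fence_letter k); case: (fence_letter k.+1); case: (prev i k);
    case: (i k); case: (i k.+1); case: (edge_bit m (old_rail w k.+1));
    by case: (edge_bit m (rung w k.+1)).
have iP : fence_ideal i by split=> // k kn; case: (key k.+1 (ltnW kn)).
exists i => //; apply: (snake_edges_eq ms); first exact: matching_of_snake.
move=> k kn; have [-> -> ->] := matching_of_bits i kn.
by have [-> -> _] := key k kn; rewrite bitC.
Qed.

Lemma matching_of_symdiff i :
  matching_of i `+` base_matching = boundary (squares i).
Proof. by rewrite /matching_of setYC setYA setYK set0Y. Qed.

End Matchings.

(** * The basic matching *)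

Section BasicMatching.
Variable w : word.
Local Notation n := (size w).

Lemma ends_rung k : ends (rung w k) = [set corner w k; rung_end w k].
Proof. by rewrite /rung /rung_end; case: (letter w k). Qed.

Lemma ends_new_rail k : ends (new_rail w k) = [set corner w k; rail_end w k].
Proof. by rewrite /new_rail /rail_end; case: (letter w k). Qed.

Lemma ends_old_rail k :
  ends (old_rail w k) = [set opposite_corner w k; rung_end w k].
Proof.
rewrite /old_rail /rung_end /opposite_corner.
by case: (letter w k) => /=; congr [set _; _]; apply: vertex_eq => /=; lia.
Qed.

Lemma level_opposite_corner k : level (opposite_corner w k) = k.
Proof.
rewrite -[RHS](level_corner w k) /opposite_corner /level.
by case: (letter w k) => /=; lia.
Qed.

Lemma level_rung_end k : level (rung_end w k) = k.+1.
Proof.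
have := level_corner w k.
by rewrite /rung_end /level; case: (letter w k) => /=; lia.
Qed.

Lemma level_rail_end k : level (rail_end w k) = k.+1.
Proof.
have := level_corner w k.
by rewrite /rail_end /level; case: (letter w k) => /=; lia.
Qed.

Lemma level_end k v : v = rung_end w k \/ v = rail_end w k ->
  v = corner w k.+1 \/ v = opposite_corner w k.+1.
Proof.
rewrite /rung_end /rail_end /opposite_corner cornerS.
case: (letter w k); case: (letter w k.+1) => -[] ->; auto;
  by right; apply: vertex_eq => /=; lia.
Qed.

Lemma snake_vertex_down v : snake_vertices w v <-> v = corner w 0 \/
  exists2 k, (k <= n.+1)%N & v = rung_end w k \/ (k <= n)%N /\ v = rail_end w k.
Proof.
rewrite snake_vertexE.
have top : corner w n + (1, 1) = rung_end w n.+1.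
  by rewrite /rung_end cornerS /= nth_default //; apply: vertex_eq => /=; lia.
split=> [[->|[k kn kv]|->]|[->|[k kn kv]]].
- by left.
- right; exists k; first exact: leqW.
  rewrite /rung_end /rail_end; case: (letter w k); case: kv => ->; auto.
- by right; exists n.+1 => //; left.
- exact: Or31.
- case: kv => [vk|[kn' vk]].
    move: kn; rewrite leq_eqVlt => /orP[/eqP kn|kn].
      by apply: Or33; rewrite top vk kn.
    apply: Or32; exists k => //.
    by rewrite vk /rung_end; case: (letter w k); auto.
  by apply: Or32; exists k => //; rewrite vk /rail_end; case: (letter w k); auto.
Qed.

Lemma snake_vertex_up v : snake_vertices w v -> v = rung_end w n.+1 \/
  exists2 k, (k <= n.+1)%N & v = corner w k \/ (0 < k)%N /\ v = opposite_corner w k.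
Proof.
case/snake_vertex_down=> [->|[k kn vk]]; first by right; exists 0; auto.
have [kn'|kn'] := leqP k n.
  right; exists k.+1 => //.
  have [->|->] : v = corner w k.+1 \/ v = opposite_corner w k.+1.
  - by apply: level_end; case: vk => [|[]]; auto.
  - by left.
  - by right.
case: vk => [->|[]]; last by rewrite leqNgt kn'.
by left; congr rung_end; apply/eqP; rewrite eqn_leq kn.
Qed.

Lemma snake_edge_rung k : (k <= n.+1)%N -> snake_edges w (rung w k).
Proof. by move=> kn; apply/snake_edgeE; exists k => //; apply: Or31. Qed.

Lemma snake_edge_new_rail k : (k <= n)%N -> snake_edges w (new_rail w k).
Proof.
by move=> kn; apply/snake_edgeE; exists k; [exact: leqW|exact: Or32].
Qed.

Lemma snake_edge_old_rail k :
  (0 < k)%N -> (k <= n.+1)%N -> snake_edges w (old_rail w k).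
Proof. by move=> k0 kn; apply/snake_edgeE; exists k => //; apply: Or33. Qed.

Lemma snake_rung_end k : (k <= n.+1)%N -> snake_vertices w (rung_end w k).
Proof. by move=> kn; apply/snake_vertex_down; right; exists k; auto. Qed.

Lemma snake_rail_end k : (k <= n)%N -> snake_vertices w (rail_end w k).
Proof.
move=> kn; apply/snake_vertex_down; right.
by exists k; [exact: leqW|right].
Qed.

Lemma snake_corner k : (k <= n.+1)%N -> snake_vertices w (corner w k).
Proof.
case: k => [_|k kn]; first by apply/snake_vertex_down; left.
apply/snake_vertexE/Or32; exists k => //.
by rewrite cornerS; case: (letter w k.+1); auto.
Qed.

Lemma snake_opposite_corner k :
  (0 < k)%N -> (k <= n.+1)%N -> snake_vertices w (opposite_corner w k).
Proof.
case: k => // k _ kn; apply/snake_vertexE/Or32; exists k => //.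
rewrite /opposite_corner cornerS; case: (letter w k.+1); [left|right];
  by apply: vertex_eq => /=; lia.
Qed.

Section Induced.
Variable U : set vertex.
Local Notation joined := (clos_refl_trans vertex (induced_adj w U)).

Lemma induced_adj_sym x y : induced_adj w U x y -> induced_adj w U y x.
Proof. by case=> Ux Uy [e es exy]; split=> //; exists e => //; rewrite exy setUC. Qed.

Lemma joined_sym x y : joined x y -> joined y x.
Proof.
elim=> [a b ab|a|a b c _ ba _ cb].
- by apply: rt_step; exact: induced_adj_sym.
- exact: rt_refl.
- exact: rt_trans cb ba.
Qed.

Lemma joined_top x : snake_vertices w x -> U x ->
  (forall y, snake_vertices w y -> level x < level y -> U y) ->
  joined x (rung_end w n.+1).
Proof.
have [d] := ubnP (absz (n%:Z + 2 - level x)%R); elim: d x => // d IH x dx xs Ux Uy.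
case: (snake_vertex_up xs) => [->|[k kn xk]]; first exact: rt_refl.
have lx : level x = k.
  by case: xk => [->|[_ ->]]; rewrite (level_corner, level_opposite_corner).
have lk := level_rung_end k.
have ks := snake_rung_end kn.
have Uk : U (rung_end w k) by apply: Uy => //; rewrite lk lx ltz_nat.
apply: (@rt_trans _ _ _ (rung_end w k)).
  apply: rt_step; split=> //; case: xk => [->|[k0 ->]].
    by exists (rung w k); [exact: snake_edge_rung|exact: ends_rung].
  by exists (old_rail w k); [exact: snake_edge_old_rail|exact: ends_old_rail].
apply: IH => //; first by move: dx; rewrite lk lx; lia.
by move=> y ys; rewrite lk => ky; apply: Uy => //; rewrite lx; lia.
Qed.

Lemma joined_origin x : snake_vertices w x -> U x ->
  (forall y, snake_vertices w y -> level y < level x -> U y) ->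
  joined x (corner w 0).
Proof.
have [d] := ubnP (absz (level x)); elim: d x => // d IH x dx xs Ux Uy.
case/snake_vertex_down: (xs) => [->|[k kn xk]]; first exact: rt_refl.
have lx : level x = k.+1.
  by case: xk => [->|[_ ->]]; rewrite (level_rung_end, level_rail_end).
have lk := level_corner w k.
have ks := snake_corner kn.
have Uk : U (corner w k) by apply: Uy => //; rewrite lk lx ltz_nat.
apply: (@rt_trans _ _ _ (corner w k)).
  apply/rt_step/induced_adj_sym; split=> //; case: xk => [->|[k0 ->]].
    by exists (rung w k); [exact: snake_edge_rung|exact: ends_rung].
  by exists (new_rail w k); [exact: snake_edge_new_rail|exact: ends_new_rail].
apply: IH => //; first by move: dx; rewrite lk lx; lia.
by move=> y ys; rewrite lk => ky; apply: Uy => //; rewrite lx; lia.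
Qed.
End Induced.

(* Above the removed edge everything is joined to the last vertex, below it to
   the first one, so one edge across the cut is enough. *)
Lemma not_disconnected k p q : level p = k%:Z -> level q = k.+1%:Z ->
  let U := snake_vertices w `\` [set p; q] in
  (forall x y, U x -> U y -> level x <= k -> k.+1%:Z <= level y ->
     exists p' q', [/\ level p' = k%:Z, level q' = k.+1%:Z
                     & induced_adj w U p' q']) ->
  ~ induced_disconnected w U.
Proof.
move=> pk qk U link [x [y [Ux Uy]]]; apply.
have up z : U z -> k.+1%:Z <= level z ->
    clos_refl_trans vertex (induced_adj w U) z (rung_end w n.+1).
  move=> Uz kz; apply: joined_top => //; first by case: Uz.
  move=> v vs zv; split=> // -[] /= vpq; move: zv; rewrite vpq ?pk ?qk; lia.
have down z : U z -> level z <= k%:Z ->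
    clos_refl_trans vertex (induced_adj w U) z (corner w 0).
  move=> Uz kz; apply: joined_origin => //; first by case: Uz.
  move=> v vs zv; split=> // -[] /= vpq; move: zv; rewrite vpq ?pk ?qk; lia.
have across a b : U a -> U b -> level a <= k -> k.+1%:Z <= level b ->
    clos_refl_trans vertex (induced_adj w U) a b.
  move=> Ua Ub ak kb; have [p' [q' [p'k q'k pq]]] := link a b Ua Ub ak kb.
  have [Up Uq _] := pq.
  apply: (rt_trans _ _ _ (corner w 0)); first exact: down.
  apply: (rt_trans _ _ _ p'); first by apply/joined_sym/down => //; rewrite p'k.
  apply: (rt_trans _ _ _ q'); first exact: rt_step.
  apply: (rt_trans _ _ _ (rung_end w n.+1)); first by apply: up => //; rewrite q'k.
  by apply: joined_sym; exact: up.
have [xk|xk] := lerP (level x) k; have [yk|yk] := lerP (level y) k.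
- by apply: rt_trans (down _ Ux xk) (joined_sym (down _ Uy yk)).
- by apply: across => //; lia.
- by apply/joined_sym/across => //; lia.
- by apply: rt_trans (up _ Ux _) (joined_sym (up _ Uy _)); lia.
Qed.

Lemma opposite_neq_corner k : opposite_corner w k <> corner w k.
Proof.
by rewrite /opposite_corner; case: letter => /(congr1 fst) /=; lia.
Qed.

Lemma rung_end_neq_rail_end k : rung_end w k <> rail_end w k.
Proof.
by rewrite /rung_end /rail_end; case: letter => /(congr1 fst) /=; lia.
Qed.

Lemma level_neq (u v : vertex) : level u <> level v -> u <> v.
Proof. by move=> uv e; apply: uv; rewrite e. Qed.

Lemma new_rail_boundary k : (k <= n)%N -> boundary_edge w (new_rail w k).
Proof.
move=> kn; split; first exact: snake_edge_new_rail.
case=> _; rewrite ends_new_rail; apply: (@not_disconnected k).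
- exact: level_corner.
- exact: level_rail_end.
move=> x y [xs xk] _ lx _; have k0 : (0 < k)%N.
  rewrite lt0n; apply/eqP => k0; apply: xk; left.
  case/snake_vertex_down: xs lx => [-> _|[j _ jx]]; first by rewrite k0.
  by case: jx => [->|[_ ->]]; rewrite (level_rung_end, level_rail_end) k0.
exists (opposite_corner w k), (rung_end w k).
have kn1 := leqW kn.
split; [exact: level_opposite_corner|exact: level_rung_end|split].
- split; first exact: snake_opposite_corner.
  case; first exact: opposite_neq_corner.
  by apply: level_neq; rewrite level_opposite_corner level_rail_end => -[]; lia.
- split; first exact: snake_rung_end.
  case; last exact: rung_end_neq_rail_end.
  by apply: level_neq; rewrite level_corner level_rung_end => -[]; lia.
- by exists (old_rail w k); [exact: snake_edge_old_rail|exact: ends_old_rail].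
Qed.

Lemma old_rail_boundary k : (0 < k)%N -> (k <= n.+1)%N ->
  boundary_edge w (old_rail w k).
Proof.
move=> k0 kn1; split; first exact: snake_edge_old_rail.
case=> _; rewrite ends_old_rail; apply: (@not_disconnected k).
- exact: level_opposite_corner.
- exact: level_rung_end.
move=> x y _ [ys yk] _ ly; have kn : (k <= n)%N.
  rewrite -ltnS ltn_neqAle kn1 andbT; apply/eqP => kE; apply: yk; right.
  case/snake_vertex_up: ys ly => [-> _|[j jn jy]]; first by rewrite kE.
  by case: jy => [->|[_ ->]]; rewrite (level_corner, level_opposite_corner); lia.
exists (corner w k), (rail_end w k).
split; [exact: level_corner|exact: level_rail_end|split].
- split; first exact: snake_corner.
  case; first by move/esym; exact: opposite_neq_corner.
  by apply: level_neq; rewrite level_corner level_rung_end => -[]; lia.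
- split; first exact: snake_rail_end.
  case; last by move/esym; exact: rung_end_neq_rail_end.
  by apply: level_neq; rewrite level_opposite_corner level_rail_end => -[]; lia.
- by exists (new_rail w k); [exact: snake_edge_new_rail|exact: ends_new_rail].
Qed.

Lemma rung_interior k : (0 < k)%N -> (k <= n)%N -> interior_edge w (rung w k).
Proof.
move=> k0 kn; split; first by apply/snake_edge_rung/leqW.
set U := _ `\` _.
have keep x y : clos_refl_trans vertex (induced_adj w U) x y ->
    level x <= k%:Z -> level y <= k%:Z.
{ elim=> // [a b|a b c _ ab _ bc /ab //].
  case=> -[sa Ua] [sb Ub] [e /snake_edgeE[j jn je] eab].
  rewrite ends_rung in Ua Ub.
  have [ea eb] : ends e a /\ ends e b by rewrite eab; split; [left|right].
  case: je ea eb {eab} => [->|[_ ->]|[_ ->]];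
    rewrite (ends_rung, ends_new_rail, ends_old_rail) => -[] /= aE [] /= bE; subst a b.
  all: rewrite ?level_corner ?level_opposite_corner ?level_rung_end ?level_rail_end //.
  all: move=> jk; case: (ltngtP j k) => // jkE; try (by lia).
  all: subst j; first [by case: Ua; left|by case: Ub; left
    |by case: Ub; right|by case: Ua; right|by []]. }
exists (corner w 0), (rung_end w n.+1); split.
- split; first exact: snake_corner.
  rewrite ends_rung => -[]; apply: level_neq.
    by rewrite !level_corner => -[]; lia.
  by rewrite level_corner level_rung_end => -[]; lia.
- split; first exact: snake_rung_end.
  rewrite ends_rung => -[]; apply: level_neq.
    by rewrite level_corner level_rung_end => -[]; lia.
  by rewrite !level_rung_end => -[]; lia.
- by move/keep; rewrite level_corner level_rung_end; lia.
Qed.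

Lemma squares0 i : (forall k, i k = false) -> squares w i = set0.
Proof. by move=> i0; rewrite -subset0 => g [k /=]; rewrite i0. Qed.

Lemma boundary0 : boundary set0 = set0.
Proof.
rewrite -subset0 => -[] g; rewrite /boundary /=.
  by case: asboolP => // _; case: asboolP.
by case: asboolP => // _; case: asboolP.
Qed.

Lemma matching_of0 i :
  (forall k, i k = false) -> matching_of w i = base_matching w.
Proof. by move=> i0; rewrite /matching_of squares0 // boundary0 setY0. Qed.

Lemma last_vertex : abel w + (1, 1) = rung_end w n.+1.
Proof.
rewrite (corner_prefix (prefix_refl w)) /rung_end cornerS /= nth_default //.
by apply: vertex_eq => /=; lia.
Qed.

Lemma vertical_old_rail_last : vertical (old_rail w n.+1).
Proof. by rewrite /old_rail /= nth_default. Qed.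

Lemma base_matching_basic : is_basic_matching w (base_matching w).
Proof.
split.
- rewrite -(@matching_of0 (fun=> false)) //; apply: matching_of_perfect.
  by split=> // k _; case: ifP.
- move=> e [k kn ->]; case: ifPn => kP.
    apply: old_rail_boundary => //.
    by rewrite lt0n; apply: contraTneq kP => ->; rewrite fence_letter0.
  apply: new_rail_boundary; rewrite -ltnS ltn_neqAle kn andbT.
  by apply: contraNneq kP => ->; rewrite fence_letter_last.
- exists (old_rail w n.+1); last exact: vertical_old_rail_last.
  split; first by exists n.+1 => //; rewrite fence_letter_last.
  by rewrite last_vertex ends_old_rail; right.
Qed.

Lemma is_basic_matching_unique b : is_basic_matching w b -> b = base_matching w.
Proof.
case=> /perfect_matching_of[i [i_n _] ->] bb [e [be]].
rewrite last_vertex => /ends_edgeE ev ve.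
have step k : (k.+1 <= n)%N -> i k = i k.+1.
  move=> kn; have [|_ bk _] := @matching_of_bits w i k.+1; first exact: ltnW.
  apply/eqP; rewrite -negb_add -[_ (+) _]bk; apply/edge_bitP => /bb[_]; apply.
  exact: rung_interior.
have lastF : i n = false.
  have eE : e = old_rail w n.+1.
    have es := matching_of_snake i_n be.
    have L : rung_end w n.+1 = corner w n.+1 + (1, 0).
      by rewrite /rung_end /= nth_default.
    case: ev es ve => -> // es _.
      have : level (base (Vertical (rung_end w n.+1))) = n.+2.
        exact: level_rung_end.
      by move/snake_edge_level => /(_ w es)[]; rewrite ltnn.
    rewrite L /old_rail /opposite_corner /= nth_default //.
    by congr Vertical; apply: vertex_eq => /=; lia.
  have [//|+ _ _] := @matching_of_bits w i n.+1.
  move: be; rewrite eE => /edge_bitP ->.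
  by rewrite fence_letter_last /=; case: (i n).
apply: matching_of0 => k.
have [kn|kn] := leqP k n; last by apply/negP => /i_n; rewrite leqNgt kn.
rewrite -(subKn kn); elim: (n - k)%N => [|d IH]; first by rewrite subn0.
have [dn|dn] := ltnP d n; last first.
  have <- : (n - d = n - d.+1)%N by lia.
  exact: IH.
by rewrite step subnSK // leq_subr.
Qed.

End BasicMatching.

Section Ideals.
Variable w : word.
Local Notation n := (size w).

Lemma basic_matchingE : basic_matching w = base_matching w.
Proof.
rewrite /basic_matching; case: xgetP => [b _|]; first exact: is_basic_matching_unique.
by move/(_ (base_matching w)); case; exact: base_matching_basic.
Qed.

Lemma matching_of_perp i : fence_ideal w i ->
  perp_matchings w (matching_of w i) <-> i 0.
Proof.
move=> iP; have [//|_ bB bC] := @matching_of_bits w i 0.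
have ms := matching_of_snake iP.1.
rewrite [RHS]addFb in bB; rewrite fence_letter0 addTb in bC.
have first_edgeE e : first_edge (matching_of w i) e <->
    e = if i 0 then rung w 0 else new_rail w 0.
  split=> [[me /ends_edgeE ev]|->].
    have {ev} : e = rung w 0 \/ e = new_rail w 0.
      case: ev (me) => ->; rewrite /rung /new_rail; case: (letter w 0); auto;
        by move=> /edge_bitP; rewrite (edge_bit_below ms).
    by case=> eE; move: me; rewrite eE => /edge_bitP; rewrite ?bB ?bC; case: (i 0).
  have o0 : ends (rung w 0) (0, 0) /\ ends (new_rail w 0) (0, 0).
    by rewrite ends_rung ends_new_rail; split; left.
  split; last by case: ifP => _; case: o0.
  by apply/edge_bitP; case: ifP => i0; rewrite ?bB ?bC ?i0.
have perfect := matching_of_perfect iP.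
have horE : horizontal (if i 0 then rung w 0 else new_rail w 0) = (i 0 == ~~ odd n).
  by rewrite /rung /new_rail /=; case: (i 0); case: (odd n).
split=> [[_ []]|i0].
- by case=> no [e /first_edgeE ->]; rewrite horE no => /eqP.
- by case=> no [e /first_edgeE ->]; rewrite /vertical horE no; case: (i 0).
- split=> //; case: (boolP (odd n)) => no; [right|left]; split=> //;
  (exists (rung w 0); first by apply/first_edgeE; rewrite i0);
  by move: horE; rewrite i0 /vertical => ->; rewrite ?no // (negbTE no).
Qed.

Lemma size_theta : size (theta w) = n.
Proof. by elim: w => //= a v ->. Qed.

Lemma lower_idealsE (I : {set 'I_(size (theta w)).+1}) (i : pred nat) :
  (forall k, i k -> (k <= n)%N) ->
  (forall k : 'I_(size (theta w)).+1, (k \in I) = i k) ->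
  lower_ideals (theta w) I <-> fence_ideal w i.
Proof.
move=> i_n iI; split=> [low|[_ fence]].
  split=> // k kn; rewrite -nth_theta //.
  have kE : (inord k : 'I_(size (theta w)).+1) = k :> nat.
    by rewrite inordK // size_theta; exact: leqW.
  have k1E : (inord k.+1 : 'I_(size (theta w)).+1) = k.+1 :> nat.
    by rewrite inordK // size_theta.
  have ik : (inord k \in I) = i k by rewrite iI kE.
  have ik1 : (inord k.+1 \in I) = i k.+1 by rewrite iI k1E.
  case: ifPn => kb; apply/implyP; rewrite -ik -ik1;
    apply: low; apply: connect1; by rewrite /fence_cover /= kE k1E eqxx kb ?orbT.
move=> x y /connectP[p]; elim: p x => [|z p IH] x /=; first by move=> _ ->.
case/andP=> xz zp yz yI; have := IH _ zp yz yI; rewrite !iI.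
have lt (k : 'I_(size (theta w)).+1) : (k <= n)%N by rewrite -ltnS -size_theta.
case/orP: xz => /andP[/eqP xE].
  move: (lt x); rewrite xE => kn; rewrite nth_theta // => /negbTE kb.
  by have := fence z kn; rewrite kb => /implyP.
move: (lt z); rewrite xE => kn; rewrite nth_theta // => kb.
by have := fence x kn; rewrite kb => /implyP.
Qed.

End Ideals.

(** * Regions enclosed by boundaries of sets of squares *)

Section Region.
Variable R : realType.
Implicit Types (S : set vertex) (z : R * R) (g : vertex).

Definition union_squares S : set (R * R) := \bigcup_(g in S) unit_square R g.

Lemma unit_squareP g z : unit_square R g z <->
  (g.1%:~R <= z.1 <= g.1%:~R + 1) /\ (g.2%:~R <= z.2 <= g.2%:~R + 1).
Proof. by rewrite /unit_square /setX /= !in_itv /=. Qed.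

Lemma near_unit_interval (x : R) : \forall x' \near x, exists a : int,
  (a%:~R <= x <= a%:~R + 1) && (a%:~R <= x' <= a%:~R + 1).
Proof.
have := floor_itv x; rewrite intrD => /andP[ax xa].
move: ax; rewrite le_eqVlt => /orP[/eqP ax|ax].
  have : \forall x' \near x, x' \in `](x - 1), (x + 1)[.
    by apply: near_in_itvoo; rewrite in_itv /=; lra.
  apply: filterS => x'; rewrite in_itv /= => /andP[x'1 x'2].
  have [xx'|x'x] := lerP x x'.
    by exists (Num.floor x); rewrite ax; apply/andP; split; lra.
  by exists (Num.floor x - 1); rewrite intrD ax; apply/andP; split; lra.
have : \forall x' \near x, x' \in `](Num.floor x)%:~R, ((Num.floor x)%:~R + 1)[.
  by apply: near_in_itvoo; rewrite in_itv /= ax.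
apply: filterS => x'; rewrite in_itv /= => /andP[x'1 x'2].
by exists (Num.floor x); apply/andP; split; lra.
Qed.

Lemma near_common_square z : \forall z' \near z, exists g,
  unit_square R g z /\ unit_square R g z'.
Proof.
exists ([set x' | exists a : int,
    (a%:~R <= z.1 <= a%:~R + 1) && (a%:~R <= x' <= a%:~R + 1)],
  [set y' | exists a : int,
    (a%:~R <= z.2 <= a%:~R + 1) && (a%:~R <= y' <= a%:~R + 1)]).
  by split; exact: near_unit_interval.
move=> z' [[a /andP[az az']] [b /andP[bz bz']]].
by exists (a, b); split; apply/unit_squareP.
Qed.

Lemma interval_neighbours (a b : int) (x : R) : a%:~R <= x <= a%:~R + 1 ->
  b%:~R <= x <= b%:~R + 1 ->
  [\/ a = b, b = a + 1 /\ x = b%:~R | a = b + 1 /\ x = a%:~R].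
Proof.
move=> /andP[ax xa] /andP[bx xb].
have ab : a <= b + 1 by rewrite -(ler_int R) intrD; lra.
have ba : b <= a + 1 by rewrite -(ler_int R) intrD; lra.
have [ab'|ab'|ab'] := ltgtP a b; last exact: Or31.
  have bE : b = a + 1 by lia.
  by apply: Or32; split=> //; apply/eqP; rewrite eq_le bx andbT bE intrD.
have aE : a = b + 1 by lia.
by apply: Or33; split=> //; apply/eqP; rewrite eq_le ax andbT aE intrD.
Qed.

Lemma boundary_vertical S (a b : int) : ~ boundary S (Vertical (a + 1, b)) ->
  S (a, b) <-> S (a + 1, b).
Proof.
rewrite /boundary /=.
have -> : ((a + 1, b) : vertex) - (1, 0) = (a, b) by apply: vertex_eq => /=; lia.
by case: asboolP; case: asboolP.
Qed.

Lemma boundary_horizontal S (a b : int) : ~ boundary S (Horizontal (a, b + 1)) ->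
  S (a, b) <-> S (a, b + 1).
Proof.
rewrite /boundary /=.
have -> : ((a, b + 1) : vertex) - (0, 1) = (a, b) by apply: vertex_eq => /=; lia.
by case: asboolP; case: asboolP.
Qed.

(* Two unit squares sharing [z] are linked by at most two moves, each of which
   crosses an edge through [z]. *)
Lemma squares_around S g h z : ~ drawing R (boundary S) z ->
  unit_square R g z -> unit_square R h z -> S g -> S h.
Proof.
case: g => a b; case: h => c d zS /unit_squareP[/= az bz] /unit_squareP[/= cz dz].
have off e : segment R e z -> ~ boundary S e by move=> ez eS; apply: zS; exists e.
have vert a' : z.1 = (a' + 1)%:~R -> S (a', b) <-> S (a' + 1, b).
  move=> za; apply: boundary_vertical; apply: off.
  by split=> //=; rewrite in_itv.
have hor b' : z.2 = (b' + 1)%:~R -> S (c, b') <-> S (c, b' + 1).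
  move=> zb; apply: boundary_horizontal; apply: off.
  by split=> //=; rewrite in_itv.
have {}vert : S (a, b) -> S (c, b).
  case: (interval_neighbours az cz) => [->//|[cE zE]|[aE zE]].
    by rewrite cE; apply: (iffLR (vert _ _)); rewrite zE cE.
  by rewrite aE; apply: (iffRL (vert _ _)); rewrite zE aE.
move/vert; case: (interval_neighbours bz dz) => [->//|[dE zE]|[bE zE]].
  by rewrite dE; apply: (iffLR (hor _ _)); rewrite zE dE.
by rewrite bE; apply: (iffRL (hor _ _)); rewrite zE bE.
Qed.

Lemma drawing_boundary S : drawing R (boundary S) `<=` union_squares S.
Proof.
move=> z [e eS ez].
suff [g gS gz] : exists2 g, S g & unit_square R g z by exists g.
case: e eS ez => -[a b]; rewrite /boundary /=.
- case: asboolP => [Sg _|_ /asboolP Sg] [/=]; rewrite in_itv /= => az bz.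
    by exists (a, b) => //; apply/unit_squareP; rewrite az bz /=; split=> //; lra.
  eexists; first exact: Sg.
  apply/unit_squareP; rewrite /= bz subr0 az; split=> //.
  by rewrite intrD mulrNz; lra.
- case: asboolP => [Sg _|_ /asboolP Sg] [/=]; rewrite in_itv /= => az bz.
    by exists (a, b) => //; apply/unit_squareP; rewrite az bz /=; split=> //; lra.
  eexists; first exact: Sg.
  apply/unit_squareP; rewrite /= az subr0 bz; split=> //.
  by rewrite intrD mulrNz; lra.
Qed.

Lemma closed_unit_square g : closed (unit_square R g).
Proof.
have -> : unit_square R g = fst @^-1` `[g.1%:~R, g.1%:~R + 1] `&`
    snd @^-1` `[g.2%:~R, g.2%:~R + 1] by [].
apply: closedI; apply: closed_comp; try exact: itv_closed.
  by move=> z _; exact: cvg_fst.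
by move=> z _; exact: cvg_snd.
Qed.

Lemma bounded_normP (A : set (R * R)) : bounded_set A <->
  exists M : R, forall z, A z -> `|z.1| <= M /\ `|z.2| <= M.
Proof.
split=> [/pinfty_ex_gt0[M _ AM]|[M AM]].
  by exists M => z /AM /=; rewrite prod_normE ge_max => /andP.
exists M; split; first exact: num_real.
move=> N MN z /AM[z1 z2] /=; rewrite prod_normE ge_max.
by rewrite !(le_trans _ (ltW MN)).
Qed.

Lemma region_boundary S :
  closed (union_squares S) -> bounded_set (union_squares S) ->
  (forall z, ~ union_squares S z -> exists B : set (R * R),
     [/\ B z, connected B, B `<=` ~` union_squares S & ~ bounded_set B]) ->
  region R (boundary S) = union_squares S.
Proof.
move=> U_closed U_bounded escape; apply/seteqP; split=> z.
  case=> [/drawing_boundary//|[zD zb]]; apply: contrapT => zU.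
  have [B [Bz Bc BU Bunb]] := escape z zU.
  apply: Bunb; have [M CM] := iffLR (bounded_normP _) zb.
  apply/bounded_normP; exists M => y By; apply: CM.
  apply: connected_component_max Bz _ Bc _ By.
  by move=> x Bx xD; apply: (BU x Bx); exact: drawing_boundary.
move=> zU; have [zD|zD] := pselect (drawing R (boundary S) z); first by left.
right; split=> //; set C := connected_component _ _.
have CD : C `<=` ~` drawing R (boundary S) by exact: connected_component_sub.
have Cz : C z by exact: connected_component_refl.
suff CU : C `&` union_squares S = C.
  have [M UM] := iffLR (bounded_normP _) U_bounded.
  by apply/bounded_normP; exists M => y Cy; apply: UM; rewrite -CU in Cy; case: Cy.
apply: (@component_connected _ (~` drawing R (boundary S)) z).
- by exists z.
- exists (interior (union_squares S)); first exact: open_interior.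
  apply/seteqP; split=> y [Cy yU]; split=> //; last exact: interior_subset.
  case: yU => g Sg gy; apply: filterS (near_common_square y) => y' [h [hy hy']].
  by exists h => //; exact: (squares_around (CD y Cy) gy hy).
- by exists (union_squares S).
Qed.

End Region.

Section SnakeRegion.
Variables (R : realType) (w : word) (i : pred nat).
Local Notation n := (size w).
Hypothesis i_n : forall k, i k -> (k <= n)%N.
Local Notation U := (@union_squares R (squares w i)).
Local Notation cx k := ((corner w k).1%:~R : R).
Local Notation cy k := ((corner w k).2%:~R : R).

Lemma union_squaresP (x y : R) : U (x, y) <-> exists2 k, i k &
  (cx k <= x <= cx k + 1) /\ (cy k <= y <= cy k + 1).
Proof.
split=> [[g [k ik <-]] /unit_squareP zk|[k ik zk]]; first by exists k.
by exists (corner w k); [exists k|exact/unit_squareP].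
Qed.

Lemma corner_step k : (cx k.+1 = cx k + 1 /\ cy k.+1 = cy k) \/
  (cx k.+1 = cx k /\ cy k.+1 = cy k + 1).
Proof.
rewrite cornerS; case: (letter w k.+1); [right|left];
  by rewrite /= !intrD /= ?addr0.
Qed.

Lemma corner_level k : cx k + cy k = k%:R.
Proof. by rewrite -intrD; have := level_corner w k; rewrite /level => ->. Qed.

Lemma finite_squares : finite_set (squares w i).
Proof.
apply: (@sub_finite_set _ _ [set corner w k | k in `I_n.+1]).
  by move=> g [k ik <-]; exists k => //=; rewrite ltnS i_n.
exact/finite_image/finite_II.
Qed.

Lemma closed_union : closed U.
Proof. by apply: closed_bigcup finite_squares _ => g _; exact: closed_unit_square. Qed.

Lemma corner_ge0 k : 0 <= cx k /\ 0 <= cy k.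
Proof. by rewrite !ler0z. Qed.

Lemma bounded_union : bounded_set U.
Proof.
apply/bounded_normP; exists (n%:R + 1) => -[x y] /union_squaresP[k /i_n kn [kx ky]].
have [x0 y0] := corner_ge0 k; have kl := corner_level k.
have kn' : k%:R <= n%:R :> R by rewrite ler_nat.
by rewrite !ler_norml /=; split; apply/andP; split; lra.
Qed.

Definition antidiagonal (x y e t : R) : R * R := (x - e * t, y + e * t).

Lemma continuous_pair (f g : R -> R) :
  continuous f -> continuous g -> continuous (fun u => (f u, g u)).
Proof.
move=> cf cg u.
exact: (@cvg_pair _ _ _ (nbhs u) (nbhs (f u)) (nbhs (g u)) _ _ _ f g (cf u) (cg u)).
Qed.

Lemma connected_image_itv (f : R -> R * R) (b : interval R) :
  continuous f -> connected (f @` [set` b]).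
Proof.
move=> cf; apply: connected_continuous_connected.
  by apply/connected_intervalP; exact: interval_is_interval.
exact: continuous_subspaceT.
Qed.

Lemma index_gap (a : int) (p q : nat) :
  p%:R < a%:~R + 1 :> R -> a%:~R < q%:R + 2 :> R -> (p <= q.+1)%N.
Proof.
move=> pa aq; have pa' : p%:Z < a + 1 by rewrite -(ltr_int R) intrD.
have aq' : a < q%:Z + 2 by rewrite -(ltr_int R) intrD.
by clear - pa' aq'; lia.
Qed.

(* Squares meeting the antidiagonal through [z] have consecutive indices, so
   they cannot meet it on both sides of [z] without one of them containing [z]. *)
Lemma antidiagonal_escape (x y : R) (a : int) : ~ U (x, y) ->
  a%:~R < x + y < a%:~R + 1 ->
  exists2 e : R, e = 1 \/ e = -1 & forall t, 0 <= t ->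
    ~ U (antidiagonal x y e t).
Proof.
move=> zU /andP[az za]; apply: contrapT => no_escape.
have hit (e : R) : e = 1 \/ e = -1 -> exists t : R, 0 <= t /\ U (antidiagonal x y e t).
  move=> e1; apply: contrapT => noU; apply: no_escape; exists e => // t t0 tU.
  by apply: noU; exists t.
have [t [t0 /union_squaresP[j ij [jx jy]]]] := hit 1 (or_introl erefl).
have [t' [t'0 /union_squaresP[k ik [kx ky]]]] := hit (-1) (or_intror erefl).
have outside l : i l -> ~ ((cx l <= x <= cx l + 1) /\ (cy l <= y <= cy l + 1)).
  by move=> il zl; apply: zU; apply/union_squaresP; exists l.
have := outside j ij; have := outside k ik.
have jl := corner_level j; have kl := corner_level k.
have jk : (j <= k.+1)%N by apply: (@index_gap a); lra.
have kj : (k <= j.+1)%N by apply: (@index_gap a); lra.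
have jkE : j = k \/ j = k.+1 \/ k = j.+1 by clear - jk kj; lia.
move: jx jy kx ky jl kl; case: jkE => [->|[->|->]].
- by move=> jx jy kx ky _ _ _; apply; split; lra.
- have [[-> ->]|[-> ->]] := corner_step k; move=> jx jy kx ky _ _.
  + have [xc|xc] := lerP x (cx k + 1); first by move=> + _; apply; split; lra.
    by move=> _; apply; split; lra.
  + have [xc|xc] := lerP y (cy k + 1); first by move=> + _; apply; split; lra.
    by move=> _; apply; split; lra.
- have [[-> ->]|[-> ->]] := corner_step j; move=> jx jy kx ky _ _.
  + have [xc|xc] := lerP x (cx j + 1); first by move=> _; apply; split; lra.
    by move=> + _; apply; split; lra.
  + have [xc|xc] := lerP y (cy j + 1); first by move=> _; apply; split; lra.
    by move=> + _; apply; split; lra.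
Qed.

Lemma nudge z : ~ U z -> exists (t : R) (a : int), [/\ 0 <= t,
  a%:~R < z.1 + t + z.2 < a%:~R + 1 &
  forall u, 0 <= u <= t -> ~ U (z.1 + u, z.2)].
Proof.
move=> zU.
have : nbhs z (~` U) by apply: open_nbhs_nbhs; split=> //; exact/closed_openC/closed_union.
case/nbhs_ballP => r /= r0 rU.
pose a := Num.floor (z.1 + z.2).
have := floor_itv (z.1 + z.2); rewrite intrD -/a => /andP[az za].
pose t := Num.min r (a%:~R + 1 - (z.1 + z.2)) / 2.
have t0 : 0 < t by rewrite divr_gt0 // lt_min r0 /=; lra.
have [tr ta] : t <= r / 2 /\ t <= (a%:~R + 1 - (z.1 + z.2)) / 2.
  by rewrite /t; split; rewrite ler_pM2r ?invr_gt0 // ge_min lexx ?orbT.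
exists t, a; split; [exact: ltW|apply/andP; split; lra|].
move=> u u0; apply: rU; split => /=; last exact: ballxx.
by rewrite /ball /= ltr_norml; apply/andP; split; lra.
Qed.

Lemma escape z : ~ U z -> exists B : set (R * R),
  [/\ B z, connected B, B `<=` ~` U & ~ bounded_set B].
Proof.
move=> zU; have [t [a [t0 at_ off]]] := nudge zU.
pose z' := (z.1 + t, z.2).
have ot : 0 <= t <= t by rewrite t0 lexx.
have [e e1 ray] := antidiagonal_escape (off t ot) at_.
have ez : antidiagonal z'.1 z'.2 e 0 = z' by rewrite /antidiagonal !mulr0 subr0 addr0.
exists ([set (z.1 + u, z.2) | u in `[0, t]] `|`
        [set antidiagonal z'.1 z'.2 e u | u in `[0, +oo[]).
split.
- left; exists 0; first by rewrite /= in_itv /= lexx.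
  by rewrite addr0; case: z {zU t0 at_ off z' ray ez ot}.
- apply: connectedU.
  + exists z'; split; first by exists t => //; rewrite /= in_itv /= t0 lexx.
    by exists 0 => //; rewrite /= in_itv /= lexx.
  + apply/connected_image_itv/continuous_pair => u; last exact: cvg_cst.
    by apply: cvgD; [exact: cvg_cst|exact: cvg_id].
  + apply/connected_image_itv/continuous_pair => u.
      apply: cvgB; [exact: cvg_cst|apply: cvgM; [exact: cvg_cst|exact: cvg_id]].
    apply: cvgD; [exact: cvg_cst|apply: cvgM; [exact: cvg_cst|exact: cvg_id]].
- move=> y [[u /= ut <-]|[u /= u0 <-]].
    by apply: off; move: ut; rewrite in_itv.
  by apply: ray; move: u0; rewrite in_itv /= andbT.
- move/bounded_normP => [M BM].
  have MB := ler_norm M; have M0 := normr_ge0 M.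
  have [] := BM (antidiagonal z'.1 z'.2 e (M + 1 + `|z'.1|)).
    right; exists (M + 1 + `|z'.1|) => //; rewrite /= in_itv /= andbT.
    have [] := BM z; last by have := normr_ge0 z.1; have := normr_ge0 z'.1; lra.
    left; exists 0; first by rewrite /= in_itv /= lexx.
    by rewrite addr0; case: z {zU t0 at_ off z' ray ez BM ot}.
  rewrite /antidiagonal; move: (z'.1) => x.
  have := ler_norm x; have := lerNnormlW (lexx `|x|).
  by rewrite /= ler_norml; case: e1 => ->; lra.
Qed.

Lemma region_squares : region R (boundary (squares w i)) = U.
Proof. exact: region_boundary closed_union bounded_union escape. Qed.

Lemma unit_square_in_union k : unit_square R (corner w k) `<=` U <-> i k.
Proof.
split=> [kU|ik]; last by move=> z zk; exists (corner w k) => //; exists k.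
have /kU/union_squaresP[j ij [jx jy]] :
    unit_square R (corner w k) (cx k + 2^-1, cy k + 2^-1).
  by apply/unit_squareP; split=> /=; lra.
suff : corner w j = corner w k.
  by move/(congr1 level); rewrite !level_corner => -[<-].
have inteq (a b : int) : a%:~R <= (b%:~R + 2^-1 : R) <= a%:~R + 1 -> a = b.
  move=> ab; have : a < b + 1 by rewrite -(ltr_int R) intrD; lra.
  have : b < a + 1 by rewrite -(ltr_int R) intrD; lra.
  by clear; lia.
by apply: vertex_eq; exact: inteq.
Qed.

End SnakeRegion.

(** * Area and conclusion *)

Section Area.
Variables (R : realType) (w : word) (i : pred nat).
Local Notation n := (size w).
Hypothesis i_n : forall k, i k -> (k <= n)%N.
Local Notation U := (@union_squares R (squares w i)).
Local Notation mu := (@lebesgue_measure R \x @lebesgue_measure R)%E.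

(* Closed for [b = false], without its top and right sides for [b = true]. *)
Definition square_upto (b : bool) (g : vertex) : set (R * R) :=
  [set` Interval (BLeft g.1%:~R) (BSide b (g.1%:~R + 1))] `*`
  [set` Interval (BLeft g.2%:~R) (BSide b (g.2%:~R + 1))].

Lemma measurable_square b g : measurable (square_upto b g).
Proof. by apply: measurableX; exact: measurable_itv. Qed.

Lemma area_square b g : mu (square_upto b g) = 1%E.
Proof.
have len (a : R) : lebesgue_measure [set` Interval (BLeft a) (BSide b (a + 1))] = 1%E.
  rewrite lebesgue_measure_itv /= lte_fin ltrDl ltr01 -EFinB.
  by rewrite addrAC subrr add0r.
rewrite product_measure1E; [|exact: measurable_itv|exact: measurable_itv].
by rewrite [X in (X * _)%E]len [X in (_ * X)%E]len mule1.
Qed.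

Lemma area_union : mu U = (\sum_(k < n.+1) (i k)%:R)%:E.
Proof.
pose F b k := if i k then square_upto b (corner w k) else set0.
have Fm b k : measurable (F b k).
  by rewrite /F; case: ifP => _; [exact: measurable_square|exact: measurable0].
have sumF b : (\sum_(k < n.+1) mu (F b k) = (\sum_(k < n.+1) (i k)%:R)%:E)%E.
  rewrite -sumEFin; apply: eq_bigr => k _; rewrite /F; case: ifP => _.
    exact: area_square.
  exact: measure0.
have UE : U = \big[setU/set0]_(k < n.+1) F false k.
  rewrite -(bigcup_mkord n.+1 (F false)); apply/seteqP; split.
    move=> z [g [k ik <-] zk]; exists k; first by rewrite /= ltnS i_n.
    by rewrite /F ik.
  move=> z [k _]; rewrite /F; case: ifP => // ik zk.
  by exists (corner w k) => //; exists k.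
apply/eqP; rewrite eq_le; apply/andP; split.
  by rewrite UE -(sumF false); apply: Boole_inequality => k _; exact: Fm.
have disj : trivIset setT (F true).
  move=> j k _ _ [[x y] []]; rewrite /F; case: ifP => // _ + ; case: ifP => // _.
  move=> [/=]; rewrite !in_itv /= => jx jy [/=]; rewrite !in_itv /= => kx ky.
  have inteq (a b : int) (t : R) :
      a%:~R <= t < a%:~R + 1 -> b%:~R <= t < b%:~R + 1 -> a = b.
    move=> at_ bt; have : a < b + 1 by rewrite -(ltr_int R) intrD; lra.
    have : b < a + 1 by rewrite -(ltr_int R) intrD; lra.
    by clear; lia.
  have : corner w j = corner w k by apply: vertex_eq; [exact: inteq jx kx|exact: inteq jy ky].
  by move/(congr1 level); rewrite !level_corner => -[].
rewrite -(sumF true) -(measure_bigsetU mu (Fm true) disj).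
apply: le_measure; rewrite ?inE.
- by apply: bigsetU_measurable => k _; exact: Fm.
- by rewrite UE; apply: bigsetU_measurable => k _; exact: Fm.
- rewrite UE; elim/big_ind2: _ => // [A B C D AB CD|k _]; first exact: setUSS.
  rewrite /F; case: ifP => // _; move: (corner w k) => g [x y] [].
  rewrite /square_upto /setX /= !in_itv /=.
  by move=> /andP[-> /ltW ->] /andP[-> /ltW ->].
Qed.

End Area.

Section Bijection.
Variables (R : realType) (w : word).
Local Notation n := (size w).

Lemma matching_region_of (i : pred nat) : (forall k, i k -> (k <= n)%N) ->
  matching_region R w (matching_of w i) = @union_squares R (squares w i).
Proof.
by move=> i_n; rewrite /matching_region basic_matchingE matching_of_symdiff region_squares.
Qed.

Lemma Phi_matching_of (i : pred nat) (k : 'I_(size (theta w)).+1) :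
  (forall k, i k -> (k <= n)%N) -> (k \in Phi R w (matching_of w i)) = i k.
Proof.
move=> i_n; have kn : (k <= n)%N by rewrite -ltnS -(size_theta w).
rewrite inE; apply/asboolP/idP.
  case=> p [s [ws pk]]; have pw : prefix p w by apply/prefixP; exists s.
  rewrite (corner_prefix pw) pk.
  by rewrite matching_region_of // => /unit_square_in_union.
move=> ik; exists (take k w), (drop k w); split; first by rewrite cat_take_drop.
  by rewrite size_takel.
by rewrite corner_take // matching_region_of //; apply/unit_square_in_union.
Qed.

Lemma Phi_lower_ideal i :
  fence_ideal w i -> lower_ideals (theta w) (Phi R w (matching_of w i)).
Proof.
move=> iP; apply/(@lower_idealsE w _ i) => // [|k]; first by case: iP.
by apply: Phi_matching_of; case: iP.
Qed.

Lemma Phi_bij :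
  set_bij (perfect_matchings w) (lower_ideals (theta w)) (Phi R w).
Proof.
split.
- by move=> m /perfect_matching_of[i iP ->]; exact: Phi_lower_ideal.
- move=> m m'; rewrite !inE => /perfect_matching_of[i iP ->].
  move=> /perfect_matching_of[i' iP' ->] /setP eqPhi.
  suff -> : i = i' by [].
  apply/funext => k; have [kn|kn] := leqP k n; last first.
    apply/idP/idP => [/iP.1|/iP'.1]; by rewrite leqNgt kn.
  have kE : (inord k : 'I_(size (theta w)).+1) = k :> nat by rewrite inordK // size_theta.
  have := eqPhi (inord k); rewrite !Phi_matching_of ?kE //; first by case: iP'.
  by case: iP.
- move=> I low; pose i k := [exists x in I, val x == k].
  have iI (k : 'I_(size (theta w)).+1) : (k \in I) = i k.
    apply/idP/existsP => [kI|[x /andP[xI /eqP xk]]].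
      by exists k; rewrite kI /=.
    by rewrite -(val_inj xk).
  have i_n k : i k -> (k <= n)%N.
    by case/existsP=> x /andP[_ /eqP <-]; rewrite -ltnS -(size_theta w); exact: ltn_ord.
  exists (matching_of w i).
    by apply: matching_of_perfect; apply/(lower_idealsE i_n iI).
  by apply/setP => k; rewrite Phi_matching_of.
Qed.

Lemma Phi_perp m : perfect_matchings w m ->
  perp_matchings w m <-> lower_ideals_with0 (theta w) (Phi R w m).
Proof.
case/perfect_matching_of=> i iP ->; rewrite matching_of_perp //.
rewrite /lower_ideals_with0 /= Phi_matching_of; last by case: iP.
by split=> [i0|[]//]; split=> //; exact: Phi_lower_ideal.
Qed.

Lemma Phi_parallel m : perfect_matchings w m ->
  parallel_matchings w m <-> lower_ideals_without0 (theta w) (Phi R w m).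
Proof.
move=> mP; have perp := Phi_perp mP; have [Phi_low _ _] := Phi_bij.
have low := Phi_low _ mP.
split=> [[_ np]|[_ /negP n0]]; split=> //.
  by apply/negP => i0; apply: np; apply/perp.
by move/perp => -[].
Qed.

Lemma Phi_area m : perfect_matchings w m ->
  area (matching_region R w m) = (#|Phi R w m|%:R)%:E.
Proof.
case/perfect_matching_of=> i [i_n _] ->.
rewrite /area matching_region_of // area_union // -size_theta -natr_sum.
congr ((_%:R)%:E); rewrite -sum1_card [RHS]big_mkcond /=.
by apply: eq_bigr => k _; rewrite Phi_matching_of //; case: (i k).
Qed.

Lemma Phi_monotone m m' : matching_le R w m m' -> Phi R w m \subset Phi R w m'.
Proof.
move=> le; apply/fintype.subsetP => k.
rewrite inE => /asboolP[p [s [ws pk pm]]]; rewrite inE; apply/asboolP.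
by exists p, s; split=> // z /pm /le.
Qed.

End Bijection.

Theorem theorem8p1 (R : realType) (w : word) :
  set_bij (perfect_matchings w) (lower_ideals (theta w)) (Phi R w) /\
  (forall m m' : set edge, perfect_matchings w m -> perfect_matchings w m' ->
     matching_le R w m m' -> Phi R w m \subset Phi R w m') /\
  (forall m : set edge, perfect_matchings w m ->
     (perp_matchings w m <-> lower_ideals_with0 (theta w) (Phi R w m))) /\
  (forall m : set edge, perfect_matchings w m ->
     (parallel_matchings w m <-> lower_ideals_without0 (theta w) (Phi R w m))) /\
  (forall m : set edge, perfect_matchings w m ->
     area (matching_region R w m) = (#|Phi R w m|%:R)%:E).
Proof.
split; first exact: Phi_bij.
split; first by move=> m m' _ _; exact: Phi_monotone.
split; first exact: Phi_perp.
split; [exact: Phi_parallel|exact: Phi_area].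
Qed.
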